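(* Let $z\in\mathbb{N}$, $z\ge 1$. Then the integrality gap of the semidefinite program $\mathrm{SDP}_2$ (the symmetry-reduced QAP relaxation of the traveling salesman problem defined in the context) is at least $z$; that is, $$\sup_{D\in\mathcal{D}} \frac{\mathrm{OPT}_{\mathrm{TSP}}(D)}{\mathrm{OPT}_{\mathrm{SDP}_2}(D)}\ \ge\ z .$$
   Context: TSP: an instance on $N$ vertices is a symmetric matrix $D=(d_{ij})\in\mathbb{R}^{N\times N}$ with $d_{ij}\ge 0$, $d_{ii}=0$ and $d_{ij}\le d_{ik}+d_{kj}$ for all $i,j,k$ (distinct vertices may be at distance $0$). $\mathcal{D}$ is the set of all such matrices, over all $N\ge 3$. $\mathrm{OPT}_{\mathrm{TSP}}(D)$ is the minimum total cost of a Hamiltonian cycle in the complete graph $K_N$ with edge costs $d_{ij}$. Notation: $[m]=\{1,\dots,m\}$; $I_m$, $J_m$ are the $m\times m$ identity and all-ones matrices; $E^{(m)}_{jj}$ is the $m\times m$ matrix with a single $1$ in position $(j,j)$; $\mathbb{S}^{m\times m}$ is the set of real symmetric $m\times m$ matrices; $M[S,T]$ is the submatrix of $M$ with rows in $S$ and columns in $T$, and $M[S]=M[S,S]$; $\mathrm{Diag}(x)$ is the diagonal matrix with diagonal $x$; $\mathrm{vec}(M)$ stacks the columns of $M$; $\otimes$ is the Kronecker product; $Y\ge 0$ is entrywise nonnegativity and $Y\succeq 0$ is positive semidefiniteness. $C^{(N)}_1$ is the adjacency matrix of the $N$-cycle on $[N]$ with edges $\{i,i+1\}$ and $\{N,1\}$.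 $\mathrm{SDP}_2$: for an $N$-vertex instance $D$, put $n=N-1$, fix $r,s\in[n+1]$, and let $\alpha=[n+1]\setminus\{r\}$, $\beta=[n+1]\setminus\{s\}$, $\bar c=\mathrm{vec}\big(C^{(n+1)}_1[\alpha,\{r\}]\,D[\{s\},\beta]\big)\in\mathbb{R}^{n^2}$. Then $\mathrm{OPT}_{\mathrm{SDP}_2}(D)$ is the minimum of $$\mathrm{trace}\Big(\big(D[\beta]\otimes \tfrac12 C^{(n+1)}_1[\alpha]+\mathrm{Diag}(\bar c)\big)Y\Big)$$ over $Y\in\mathbb{S}^{n^2\times n^2}$ with $Y\ge 0$, $Y\succeq 0$ and (i) $\mathrm{trace}((I_n\otimes E^{(n)}_{jj})Y)=1$ for $j=1,\dots,n$; (ii) $\mathrm{trace}((E^{(n)}_{jj}\otimes I_n)Y)=1$ for $j=1,\dots,n$; (iii) $\mathrm{trace}\big((I_n\otimes(J_n-I_n)+(J_n-I_n)\otimes I_n)Y\big)=0$; (iv) $\mathrm{trace}((J_n\otimes J_n)Y)=n^2$. The choice of $r,s$ for each $N$ is arbitrary but fixed (one may take $r=s=1$). In the supremum, instances with $\mathrm{OPT}_{\mathrm{TSP}}(D)=0$ are disregarded, and a ratio with positive numerator and zero denominator is read as $+\infty$. *)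

(* Defs.v *)
From HB Require Import structures.
From mathcomp Require Import all_boot all_order all_algebra all_fingroup.
From mathcomp Require Import mxtens.
From mathcomp Require Import all_classical all_reals all_analysis.
Import Order.TTheory GRing.Theory Num.Theory numFieldNormedType.Exports.

Set Implicit Arguments.
Unset Strict Implicit.
Unset Printing Implicit Defensive.

Local Open Scope classical_set_scope.
Local Open Scope ring_scope.

Section Defs.
Variable R : realType.

Definition tsp_instance N (D : 'M[R]_N) : Prop :=
  [/\ D^T = D,
      forall i j, 0 <= D i j,
      forall i, D i i = 0
    & forall i j k, D i j <= D i k + D k j].

(* A Hamiltonian cycle of K_N is given by the order p 0, ..., p (N - 1) in
   which it visits the vertices; ordS is the successor modulo N. *)
Definition tour_cost N (D : 'M[R]_N) (p : 'S_N) : R :=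
  \sum_(i < N) D (p i) (p (ordS i)).

Definition OPT_TSP N (D : 'M[R]_N) : R :=
  \big[Order.min/tour_cost D 1%g]_(p : 'S_N) tour_cost D p.

Definition cycle_adj N : 'M[R]_N :=
  \matrix_(i, j) ((j == ordS i) || (i == ordS j))%:R.

(* Stacks the columns of M; the index of 'I_(q * p) attached to M i j is
   j * p + i, which is the indexing used by the Kronecker product *t. *)
Definition colvec p q (M : 'M[R]_(p, q)) : 'rV[R]_(q * p) :=
  \row_k M (mxtens_unindex k).2 (mxtens_unindex k).1.

Definition psd m (Y : 'M[R]_m) : Prop :=
  Y^T = Y /\ forall x : 'cV[R]_m, 0 <= (x^T *m Y *m x) 0 0.

Section SDP2.
Variable n : nat.

Definition SDP2_feasible (Y : 'M[R]_(n * n)) : Prop :=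
  let I : 'M[R]_n := 1%:M in
  let J : 'M[R]_n := const_mx 1 in
  let E (j : 'I_n) : 'M[R]_n := delta_mx j j in
  [/\ forall k l, 0 <= Y k l,
      psd Y
    & [/\ forall j, \tr ((I *t E j) *m Y) = 1,
      forall j, \tr ((E j *t I) *m Y) = 1,
      \tr ((I *t (J - I) + (J - I) *t I) *m Y) = 0
    & \tr ((J *t J) *m Y) = n%:R ^+ 2]].

(* row' r and col' r delete row r and column r: these are the restrictions to
   alpha = [n + 1] \ {r}, and likewise for s and beta = [n + 1] \ {s}. *)
Definition SDP2_cost (r s : 'I_n.+1) (D : 'M[R]_n.+1) : 'M[R]_(n * n) :=
  let C := cycle_adj n.+1 in
  let Ca : 'M[R]_n := row' r (col' r C) in
  let Db : 'M[R]_n := row' s (col' s D) in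
  let c : 'rV[R]_(n * n) :=
    colvec ((row' r (col r C) : 'cV[R]_n) *m (col' s (row s D) : 'rV[R]_n)) in
  Db *t (2^-1 *: Ca) + diag_mx c.

(* The infimum is a minimum: see OPT_SDP2_attained. *)
Definition OPT_SDP2 (r s : 'I_n.+1) (D : 'M[R]_n.+1) : \bar R :=
  ereal_inf [set (\tr (SDP2_cost r s D *m Y))%:E | Y in SDP2_feasible].

End SDP2.

(* r n and s n are the vertices fixed for the instances on n + 1 vertices.
   In \bar R, 0^-1 is +oo, and the numerator is positive here. *)
Definition SDP2_integrality_gap (r s : forall n, 'I_n.+1) : \bar R :=
  ereal_sup [set rho | exists n (D : 'M[R]_n.+1),
    [/\ (3 <= n.+1)%N, tsp_instance D, OPT_TSP D != 0
      & rho = ((OPT_TSP D)%:E / OPT_SDP2 (r n) (s n) D)%E]].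

End Defs.

Section Attainment.
Variable R : realType.

Lemma mxtrace_tens_colvec1 n (A B : 'M[R]_n) :
  \tr ((A *t B) *m ((colvec 1%:M)^T *m colvec 1%:M)) = \tr (A *m B^T).
Proof.
rewrite mulmxA mxtrace_mulC /mxtrace big_ord1.
have sumE (F : 'I_(n * n) -> R) :
    \sum_k F k = \sum_i \sum_j F (mxtens_index (i, j)).
  rewrite pair_big /= (reindex (@mxtens_index n n)) /=.
    by apply: eq_bigr => -[].
  by exists (@mxtens_unindex n n) => k _; rewrite ?mxtens_indexK ?mxtens_unindexK.
have wE i j : (colvec (1%:M : 'M[R]_n)) 0 (mxtens_index (i, j)) = (i == j)%:R.
  by rewrite mxE mxtens_indexK mxE eq_sym.
rewrite mxE sumE; apply: eq_bigr => i _.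
rewrite (bigD1 i) //= big1 ?addr0; last first.
  by move=> j ji; rewrite wE eq_sym (negbTE ji) mul0r.
rewrite wE eqxx mul1r mxE sumE [RHS]mxE; apply: eq_bigr => k _.
rewrite (bigD1 k) //= big1 ?addr0; last first.
  by move=> j ji; rewrite [X in _ * X]mxE wE eq_sym (negbTE ji) mulr0.
by rewrite tensmxE [X in _ * X]mxE wE eqxx mulr1 mxE.
Qed.

Lemma mxtrace_delta n (j : 'I_n) : \tr (delta_mx j j : 'M[R]_n) = 1.
Proof.
rewrite /mxtrace (bigD1 j)//= mxE eqxx big1 ?addr0// => i ij.
by rewrite mxE (negbTE ij).
Qed.

Lemma SDP2_feasible_nonempty n : @SDP2_feasible R n !=set0.
Proof.
set w : 'rV[R]_(n * n) := colvec 1%:M; exists (w^T *m w); split.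
- by move=> k l; rewrite mxE big_ord1 !mxE mulr_ge0.
- split=> [|x]; first by rewrite trmx_mul trmxK.
  rewrite mulmxA -mulmxA -trmx_mul mxE big_ord1 [X in X * _]mxE.
  by rewrite -expr2 sqr_ge0.
split.
- by move=> j; rewrite mxtrace_tens_colvec1 mul1mx mxtrace_tr mxtrace_delta.
- by move=> j; rewrite mxtrace_tens_colvec1 trmx1 mulmx1 mxtrace_delta.
- rewrite mulmxDl linearD /= !mxtrace_tens_colvec1 mul1mx trmx1 mulmx1.
  rewrite mxtrace_tr !linearB /= mxtrace1 /mxtrace.
  under eq_bigr do rewrite mxE.
  by rewrite sumr_const card_ord subrr addr0.
- rewrite mxtrace_tens_colvec1 /mxtrace.
  under eq_bigr do (rewrite mxE; under eq_bigr do rewrite !mxE mulr1).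
  by rewrite !sumr_const !card_ord expr2 -natrM mulrnA.
Qed.

Lemma mxtrace_continuous m (A : 'M[R]_m) :
  continuous (fun v : 'rV[R]_(m * m) => \tr (A *m vec_mx v)).
Proof.
have -> : (fun v : 'rV[R]_(m * m) => \tr (A *m vec_mx v)) =
    (fun v => \sum_i \sum_j A i j * v 0 (mxvec_index j i)).
  apply/funext => u; apply: eq_bigr => i _; rewrite mxE.
  by apply: eq_bigr => j _; rewrite mxE.
apply: (@continuous_big R^o) => [|i _]; first exact: (@add_continuous R^o).
apply: (@continuous_big R^o) => [|j _ v]; first exact: (@add_continuous R^o).
apply: continuousM; first exact: cst_continuous.
exact: coord_continuous.
Qed.

Lemma SDP2_feasible_compact n :
  compact [set v : 'rV[R]_((n * n) * (n * n)) | SDP2_feasible (vec_mx v)].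
Proof.
apply: bounded_closed_compact.
- exists (n%:R ^+ 2); split=> [|M ltM v [Y0 _ [_ _ _ YJ]]]; first exact: num_real.
  have n2ge0 : 0 <= n%:R ^+ 2 :> R by rewrite exprn_ge0.
  rewrite /= [leLHS]/Num.norm /= mx_normrE (bigmax_le _ _)//=.
    exact: le_trans n2ge0 (ltW ltM).
  case=> i k _ /=; rewrite (ord1 i); case/mxvec_indexP: k => k l.
  apply: le_trans (ltW ltM).
  have vE a b : v 0 (mxvec_index a b) = (vec_mx v) a b by rewrite mxE.
  rewrite vE ger0_norm // -YJ /mxtrace.
  rewrite (bigD1 l)//= -[leLHS]addr0 lerD ?sumr_ge0//.
    rewrite [leRHS]mxE (bigD1 k)//= [(_ *t _) _ _]mxE ![const_mx 1 _ _]mxE mulr1 mul1r.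
    rewrite -[leLHS]addr0 lerD// sumr_ge0// => j _.
    by rewrite [(_ *t _) _ _]mxE ![const_mx 1 _ _]mxE mulr1 mul1r.
  move=> a _; rewrite mxE sumr_ge0// => j _.
  by rewrite [(_ *t _) _ _]mxE ![const_mx 1 _ _]mxE mulr1 mul1r.
have trC (A : 'M[R]_(n * n)) (B : set R) : closed B ->
    closed [set v : 'rV[R]_((n * n) * (n * n)) | B (\tr (A *m vec_mx v))].
  by move=> cB; apply: preimage_closed => // v _; exact: mxtrace_continuous.
have trF (I : Type) (A : I -> 'M[R]_(n * n)) (B : set R) : closed B ->
    closed [set v : 'rV[R]_((n * n) * (n * n)) |
            forall i, B (\tr (A i *m vec_mx v))].
  move=> cB; have -> : [set v | forall i, B (\tr (A i *m vec_mx v))] =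
      \bigcap_i [set v | B (\tr (A i *m vec_mx v))].
    by apply/seteqP; split=> [v fv i _|v fv i] /=; exact: fv.
  by apply: closed_bigI => i _; exact: trC.
have trE (Y : 'M[R]_(n * n)) k l : Y k l = \tr (delta_mx l k *m Y).
  rewrite /mxtrace (bigD1 l)//= big1 ?addr0 => [|i il]; rewrite mxE (bigD1 k)//=.
    rewrite !mxE !eqxx mul1r big1 ?addr0// => j jk.
    by rewrite mxE (negbTE jk) andbF mul0r.
  rewrite mxE (negbTE il) mul0r add0r big1// => j jk.
  by rewrite mxE (negbTE il) mul0r.
have -> : [set v : 'rV[R]_((n * n) * (n * n)) | SDP2_feasible (vec_mx v)] =
  [set v | forall kl : 'I_(n * n) * 'I_(n * n),
     0 <= \tr (delta_mx kl.2 kl.1 *m vec_mx v)] `&`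
  [set v | forall kl : 'I_(n * n) * 'I_(n * n),
     \tr ((delta_mx kl.2 kl.1 - delta_mx kl.1 kl.2) *m vec_mx v) = 0] `&`
  [set v | forall x : 'cV[R]_(n * n),
     0 <= \tr (x *m x^T *m vec_mx v)] `&`
  [set v | forall j, \tr ((1%:M *t delta_mx j j : 'M[R]_(n * n)) *m vec_mx v) = 1] `&`
  [set v | forall j, \tr ((delta_mx j j *t 1%:M : 'M[R]_(n * n)) *m vec_mx v) = 1] `&`
  [set v | \tr (((1%:M *t (const_mx 1 - 1%:M) + (const_mx 1 - 1%:M) *t 1%:M)
              : 'M[R]_(n * n)) *m vec_mx v) = 0] `&`
  [set v | \tr ((const_mx 1 *t const_mx 1 : 'M[R]_(n * n)) *m vec_mx v) = n%:R ^+ 2].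
  have qE (Y : 'M[R]_(n * n)) (x : 'cV[R]_(n * n)) :
      (x^T *m Y *m x) 0 0 = \tr (x *m x^T *m Y).
    by rewrite -[in RHS]mulmxA [RHS]mxtrace_mulC /mxtrace big_ord1.
  apply/seteqP; split=> v /=.
    move=> [Y0 [YT Yx] [h1 h2 h3 h4]]; do !split=> //.
    - by move=> kl; rewrite -trE.
    - move=> [k l] /=; rewrite mulmxBl linearB /= -!trE.
      by apply/eqP; rewrite subr_eq0 -{1}YT [_^T _ _]mxE.
    - by move=> x; rewrite -qE.
  move=> [[[[[[Y0 YT] Yx] h1] h2] h3] h4]; split=> //.
  - by move=> k l; rewrite trE; exact: (Y0 (k, l)).
  - split=> [|x]; last by rewrite qE.
    apply/matrixP => k l; rewrite [LHS]mxE; apply/eqP; rewrite -subr_eq0 !trE.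
    by have := YT (l, k); rewrite mulmxBl linearB /= => ->.
repeat apply: closedI.
- by apply: (trF _ _ [set x | 0 <= x]); exact: closed_ge.
- by apply: (trF _ _ [set x | x = 0]); exact: closed_eq.
- by apply: (trF _ _ [set x | 0 <= x]); exact: closed_ge.
- by apply: (trF _ _ [set x | x = 1]); exact: closed_eq.
- by apply: (trF _ _ [set x | x = 1]); exact: closed_eq.
- by apply: (trC _ [set x | x = 0]); exact: closed_eq.
- by apply: (trC _ [set x | x = n%:R ^+ 2]); exact: closed_eq.
Qed.

Lemma OPT_SDP2_attained n (r s : 'I_n.+1) (D : 'M[R]_n.+1) :
  exists2 Y, SDP2_feasible Y
           & OPT_SDP2 r s D = (\tr (SDP2_cost r s D *m Y))%:E.
Proof.
have [Y0 FY0] := @SDP2_feasible_nonempty n.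
have ne : [set v : 'rV[R]_((n * n) * (n * n)) | SDP2_feasible (vec_mx v)] !=set0.
  by exists (mxvec Y0); rewrite /= mxvecK.
have [|v vF vmin] := compact_EVT_min ne (@SDP2_feasible_compact n)
    (f := fun v => \tr (SDP2_cost r s D *m vec_mx v)).
  by apply: continuous_subspaceT => v; exact: mxtrace_continuous.
rewrite inE /= in vF; exists (vec_mx v) => //; apply/eqP.
rewrite eq_le; apply/andP; split; first by apply: ereal_inf_lbound; exists (vec_mx v).
apply: le_ereal_inf_tmp => _ [Y FY <-]; rewrite lee_fin.
by have := vmin (mxvec Y); rewrite inE /= mxvecK; exact.
Qed.

End Attainment.

(* Main.v *)
Require Import Defs.
From mathcomp Require Import all_boot all_order all_algebra all_fingroup.
From mathcomp Require Import mxtens.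
From mathcomp Require Import all_classical all_reals all_analysis.
From mathcomp Require Import ring lra zify.
Import Order.TTheory GRing.Theory Num.Theory numFieldNormedType.Exports.
Local Open Scope ring_scope.

(* The gap is witnessed by simplicial instances: vertices are split into classes
   at mutual distance 1, with distance 0 inside a class. A tour has to leave
   every class, so it costs at least the number of classes.

   For the upper bound on the SDP, let the vertices other than [s] form [g]
   classes of size [m], so n = g m, and take for Y the matrix whose restriction
   to positions (i, j) depends only on whether the two vertices are equal,
   equivalent or inequivalent, the last two in proportions T i j and 1 - T i j.
   Such a Y is feasible as soon as T is a nonnegative positive semidefinite
   matrix with unit diagonal and all row sums equal to m = n / g. The normalised
   Fejer kernel |1 + e^(ix) + ... + e^(i(g-1)x)|^2 / g^2, sampled at the
   differences of the n-th roots of unity, satisfies all this, and it is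
   1 - O(g^2 / n^2) at neighbouring positions. The n neighbouring pairs therefore
   contribute O(g^2 / n), the two edges at [s] contribute 2, and the SDP value
   stays below 3 while g is arbitrary. *)

(** * The Fejer kernel: positivity, behaviour near 0, and sums over roots of unity *)

Section Fejer.
Set Implicit Arguments.
Unset Strict Implicit.
Variable R : realType.
Implicit Types (x a : R) (g n p : nat).

Lemma sin_le_id x : 0 <= x -> sin x <= x.
Proof.
move=> x0.
have [|c _] := @MVT_segment R (@sin R) (@cos R) 0 x x0.
  by apply: continuous_subspaceT => y; exact: continuous_sin.
by rewrite sin0 !subr0 => ->; rewrite ler_piMl // cos_le1.
Qed.

Lemma norm_sin_le x : `|sin x| <= `|x|.
Proof.
wlog x0 : x / 0 <= x => [H|].
  have [/H //|/ltW x0] := leP 0 x.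
  by rewrite -normrN -sinN -[leRHS]normrN H // oppr_ge0.
have [x1|/ltW x1] := leP x 1.
  rewrite !ger0_norm ?sin_le_id //; apply: sin_ge0_pi.
  by rewrite x0 (le_trans x1) // (le_trans _ (pi_ge2 R)) // ler1n.
by rewrite (le_trans (sin_max x)) // ger0_norm.
Qed.

Lemma one_sub_cos_le x : 1 - cos x <= x ^+ 2 / 2.
Proof.
have {1}-> : x = (x / 2) *+ 2 by lra.
rewrite cos_mulr2n cos2sin2.
have : sin (x / 2) ^+ 2 <= (x / 2) ^+ 2.
  by rewrite -real_normK ?num_real // -[leRHS]real_normK ?num_real // lerXn2r
    ?nnegrE // norm_sin_le.
by rewrite -mulr_natr; nra.
Qed.

(** Multiplying by [2 * sin (y / 2)] turns the sum into a telescoping one; this factor is nonzero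
    because [y / 2 = p / n * pi] lies strictly between 0 and [pi]. *)
Lemma sum_cos_eq0 n p a : (0 < p < n)%N ->
  \sum_(j < n) cos (a + p%:R * (2 * pi / n%:R) * j%:R) = 0 :> R.
Proof.
move=> /andP[p0 pn]; have n0 : (0 < n)%N by exact: ltn_trans p0 pn.
have nR : n%:R != 0 :> R by rewrite pnatr_eq0 -lt0n.
set y := p%:R * _.
have s0 : sin (y / 2) != 0.
  have -> : y / 2 = p%:R / n%:R * pi by rewrite /y; field.
  rewrite gt_eqF // sin_gt0_pi // mulr_gt0 ?divr_gt0 ?ltr0n ?pi_gt0 //=.
  by rewrite gtr_pMl ?pi_gt0 // ltr_pdivrMr ?ltr0n // mul1r ltr_nat.
have s2 : 2 * sin (y / 2) != 0 by rewrite mulf_neq0 // pnatr_eq0.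
apply: (mulfI s2).
rewrite mulr0 mulr_sumr.
have E (j : 'I_n) : 2 * sin (y / 2) * cos (a + y * j%:R) =
    sin (a - y / 2 + y * j.+1%:R) - sin (a - y / 2 + y * j%:R).
  have -> : a - y / 2 + y * j.+1%:R = (a + y * j%:R) + y / 2.
    by rewrite -natr1; field.
  have -> : a - y / 2 + y * j%:R = (a + y * j%:R) - y / 2 by lra.
  by rewrite sinD sinB; ring.
rewrite (eq_bigr _ (fun j _ => E j)).
rewrite -(big_mkord xpredT (fun j => sin (a - y / 2 + y * j.+1%:R) - sin (a - y / 2 + y * j%:R))).
rewrite telescope_sumr //.
(* The two endpoints of the telescoped sum differ by [p] full periods of the sine. *)
have -> : y * n%:R = (pi *+ 2) *+ p by rewrite /y -[RHS]mulr_natr -[pi *+ 2]mulr_natr; field.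
by rewrite (periodicn (@sinD2pi R)) mulr0 addr0 subrr.
Qed.

(* The normalised Fejer kernel |sum_(k < g) e^(ikx)|^2 / g^2, expanded. *)
Definition fejer g x : R :=
  g%:R ^- 2 * \sum_(k < g) \sum_(l < g) cos (k%:R * x - l%:R * x).

Lemma fejer0 g : (0 < g)%N -> fejer g 0 = 1.
Proof.
move=> g0; rewrite /fejer; under eq_bigr do under eq_bigr do
  rewrite !mulr0 subrr cos0.
rewrite !sumr_const !card_ord -mulrnA -mulr_natr mul1r natrM -expr2 mulVf //.
by rewrite expf_eq0 /= pnatr_eq0 -lt0n.
Qed.

Lemma fejerN g x : fejer g (- x) = fejer g x.
Proof.
congr (_ * _); apply: eq_bigr => k _; apply: eq_bigr => l _.
by rewrite -cosN; congr cos; ring.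
Qed.

Lemma fejerD2pi g x : fejer g (x + pi *+ 2) = fejer g x.
Proof.
congr (_ * _); apply: eq_bigr => k _; apply: eq_bigr => l _.
rewrite !cosB.
have E (m : nat) : m%:R * (x + pi *+ 2) = m%:R * x + (pi *+ 2) *+ m.
  by rewrite mulrDr [X in _ + X]mulr_natl.
by rewrite !E !(periodicn (@cosD2pi R)) !(periodicn (@sinD2pi R)).
Qed.

(** By the addition formula the double sum is [(\sum_k cos (k x)) ^ 2 + (\sum_k sin (k x)) ^ 2]. *)
Lemma fejer_ge0 g x : 0 <= fejer g x.
Proof.
rewrite mulr_ge0 ?invr_ge0 ?exprn_ge0 //.
under eq_bigr do (under eq_bigr do rewrite cosB; rewrite big_split -!mulr_sumr).
by rewrite big_split -!mulr_suml addr_ge0 // -expr2 sqr_ge0.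
Qed.

Lemma fejer_le1 g x : fejer g x <= 1.
Proof.
have [->|g0] := posnP g; first by rewrite /fejer big_ord0 mulr0.
rewrite -(fejer0 g0) ler_wpM2l ?invr_ge0 ?exprn_ge0 //.
apply: ler_sum => k _; apply: ler_sum => l _.
by rewrite !mulr0 subrr cos0 cos_le1.
Qed.

(** The left side is the average of [1 - cos ((k - l) x)] over the [g ^ 2] pairs, and
    [|k - l| <= g]. *)
Lemma one_sub_fejer_le g x : (0 < g)%N ->
  1 - fejer g x <= (g%:R * x) ^+ 2 / 2.
Proof.
move=> g0; have -> : 1 - fejer g x = fejer g 0 - fejer g x by rewrite fejer0.
rewrite -mulrBr -sumrB.
have gR : 0 < g%:R :> R by rewrite ltr0n.
rewrite ler_pdivrMl ?exprn_gt0 //.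
apply: (@le_trans _ _ (\sum_(k < g) \sum_(l < g) ((g%:R * x) ^+ 2 / 2))); last first.
  by rewrite !sumr_const !card_ord -mulrnA -[leLHS]mulr_natl natrM -expr2.
apply: ler_sum => k _; rewrite -sumrB; apply: ler_sum => l _.
rewrite !mulr0 subrr cos0 (le_trans (one_sub_cos_le _)) //.
rewrite ler_wpM2r // -mulrBl !exprMn ler_wpM2r ?sqr_ge0 //.
rewrite -[leLHS]real_normK ?num_real // lerXn2r ?nnegrE //.
have lek (i : 'I_g) : i%:R <= g%:R :> R by rewrite ler_nat ltnW.
have := lek k; have := lek l; have := ler0n R k; have := ler0n R l.
by rewrite ler_norml => *; apply/andP; split; lra.
Qed.

(** For [k <> l] the frequency satisfies [0 < |k - l| < g <= n], so the sum over [j] vanishes; the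
    [g] diagonal terms give [n] each. *)
Lemma sum_fejer g n x : (0 < g <= n)%N ->
  \sum_(j < n) fejer g (x - (2 * pi / n%:R) * j%:R) = n%:R / g%:R :> R.
Proof.
move=> /andP[g0 gn]; rewrite -mulr_sumr exchange_big /=.
set y := 2 * pi / n%:R.
have gR : g%:R != 0 :> R by rewrite pnatr_eq0 -lt0n.
suff E (k : 'I_g) : \sum_(j < n) \sum_(l < g)
    cos (k%:R * (x - y * j%:R) - l%:R * (x - y * j%:R)) = n%:R.
  rewrite (eq_bigr _ (fun k _ => E k)) sumr_const card_ord -mulr_natr.
  by field.
rewrite exchange_big /= (bigD1 k) //= [X in _ + X]big1 ?addr0 => [|l lk].
  under eq_bigr do rewrite subrr cos0.
  by rewrite sumr_const card_ord.
have [kl|lk'] := ltnP k l.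
- rewrite -[RHS](@sum_cos_eq0 n (l - k) (k%:R * x - l%:R * x)).
    apply: eq_bigr => j _; congr cos; rewrite natrB ?(ltnW kl) // -/y; ring.
  have := ltn_ord l; lia.
- have {}kl : (l < k)%N by rewrite ltn_neqAle lk' andbT.
  rewrite -[RHS](@sum_cos_eq0 n (k - l) (l%:R * x - k%:R * x)).
    apply: eq_bigr => j _; rewrite -cosN; congr cos.
    rewrite natrB ?(ltnW kl) // -/y; ring.
  have := ltn_ord k; lia.
Qed.

End Fejer.

(** * Positive semidefinite matrices and their Kronecker products *)

Section PositiveSemidefinite.
Set Implicit Arguments.
Unset Strict Implicit.
Variable R : realType.

Lemma sum_mxtens_index (V : nmodType) p q (F : 'I_(p * q) -> V) :
  \sum_k F k = \sum_i \sum_j F (mxtens_index (i, j)).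
Proof.
rewrite pair_big /= (reindex (@mxtens_index p q)) /=.
  by apply: eq_bigr => -[].
by exists (@mxtens_unindex p q) => k _; rewrite ?mxtens_indexK ?mxtens_unindexK.
Qed.

Lemma mxtrace_tens p q (A : 'M[R]_p) (B : 'M[R]_q) :
  \tr (A *t B) = \tr A * \tr B.
Proof.
rewrite /mxtrace sum_mxtens_index mulr_suml; apply: eq_bigr => i _.
by rewrite mulr_sumr; apply: eq_bigr => j _; rewrite tensmxE.
Qed.

Lemma mxtraceB m (A B : 'M[R]_m) : \tr (A - B) = \tr A - \tr B.
Proof. by rewrite linearB. Qed.

Lemma psdD m (A B : 'M[R]_m) : psd A -> psd B -> psd (A + B).
Proof.
move=> [AT A0] [BT B0]; split=> [|x]; first by rewrite linearD /= AT BT.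
by rewrite mulmxDr mulmxDl mxE addr_ge0.
Qed.

Lemma psdZ m c (A : 'M[R]_m) : 0 <= c -> psd A -> psd (c *: A).
Proof.
move=> c0 [AT A0]; split=> [|x]; first by rewrite linearZ /= AT.
by rewrite -scalemxAr -scalemxAl mxE mulr_ge0.
Qed.

Lemma psd_sum m (I : Type) (r : seq I) (P : pred I) (F : I -> 'M[R]_m) :
  (forall i, P i -> psd (F i)) -> psd (\sum_(i <- r | P i) F i).
Proof.
move=> F0; elim/big_ind: _ => //; last by move=> A B; exact: psdD.
by split=> [|x]; rewrite ?trmx0 // mulmx0 mul0mx mxE.
Qed.

Lemma psd_gram m q (A : 'M[R]_(q, m)) : psd (A^T *m A).
Proof.
split=> [|x]; first by rewrite trmx_mul trmxK.
rewrite mulmxA -mulmxA -trmx_mul mxE sumr_ge0 // => k _.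
by rewrite [X in X * _]mxE -expr2 sqr_ge0.
Qed.

Lemma psd_congr m q (A : 'M[R]_(q, m)) (S : 'M[R]_q) :
  psd S -> psd (A^T *m S *m A).
Proof.
move=> [ST S0]; split=> [|x]; first by rewrite !trmx_mul trmxK ST mulmxA.
by have := S0 (A *m x); rewrite trmx_mul !mulmxA.
Qed.

(** The matrix is block diagonal, so its quadratic form is the sum of the forms of [S] at the [p]
    blocks of [x]. *)
Lemma psd_tens1 p q (S : 'M[R]_q) : psd S -> psd ((1%:M : 'M[R]_p) *t S).
Proof.
move=> [ST S0]; split=> [|x]; first by rewrite trmx_tens trmx1 ST.
rewrite mxE sum_mxtens_index.
have E (i : 'I_p) (j : 'I_q) : (x^T *m (1%:M *t S)) 0 (mxtens_index (i, j)) =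
    ((\col_k x (mxtens_index (i, k)) 0)^T *m S) 0 j.
  rewrite mxE sum_mxtens_index (bigD1 i) //= [X in _ + X]big1 ?addr0 => [|k ki].
    by rewrite mxE; apply: eq_bigr => l _; rewrite tensmxE !mxE eqxx mul1r.
  by apply: big1 => l _; rewrite tensmxE !mxE (negbTE ki) mul0r mulr0.
apply: sumr_ge0 => i _.
have := S0 (\col_k x (mxtens_index (i, k)) 0); rewrite mxE.
by under [X in _ <= X -> _]eq_bigr do rewrite -E [X in _ * X]mxE.
Qed.

Lemma psd_tens_idem p q (E : 'M[R]_p) (S : 'M[R]_q) :
  E^T = E -> E *m E = E -> psd S -> psd (E *t S).
Proof.
move=> ET EE S0.
have -> : E *t S = (E *t 1%:M)^T *m (1%:M *t S) *m (E *t 1%:M).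
  by rewrite trmx_tens ET trmx1 !tensmx_mul mulmx1 mul1mx mulmx1 EE.
exact/psd_congr/psd_tens1.
Qed.

Lemma psd_const1 m : psd (const_mx 1 : 'M[R]_m).
Proof.
have -> : (const_mx 1 : 'M[R]_m) = (const_mx 1 : 'M[R]_(1, m))^T *m const_mx 1.
  by apply/matrixP => i j; rewrite !mxE big_ord1 !mxE mulr1.
exact: psd_gram.
Qed.

Lemma psd_cos m (a : 'I_m -> R) : psd (\matrix_(i, j) cos (a i - a j)).
Proof.
have -> : \matrix_(i, j) cos (a i - a j) =
    (\row_i cos (a i))^T *m (\row_i cos (a i)) +
    (\row_i sin (a i))^T *m (\row_i sin (a i)).
  by apply/matrixP => i j; rewrite !mxE !big_ord1 !mxE cosB.
by apply: psdD; exact: psd_gram.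
Qed.

(* [t (x_i ^ 2 + x_j ^ 2) / 2 - t x_i x_j] is a nonnegative multiple of a square,
   and summing it over [i, j] gives [c |x| ^ 2 - x^T T x]. *)
Lemma psd_scalar_sub m c (T : 'M[R]_m) : T^T = T ->
  (forall i j, 0 <= T i j) -> (forall i, \sum_j T i j = c) -> psd (c%:M - T).
Proof.
move=> TT T0 Tc; split=> [|x]; first by rewrite linearB /= tr_scalar_mx TT.
have Tsym i j : T i j = T j i by rewrite -{1}TT mxE.
have quad (S : 'M[R]_m) : (x^T *m S *m x) 0 0 = \sum_i \sum_j S i j * (x i 0 * x j 0).
  rewrite mxE; under eq_bigr do (rewrite mxE mulr_suml).
  rewrite exchange_big /=; apply: eq_bigr => i _; apply: eq_bigr => j _.
  by rewrite [x^T _ _]mxE; ring.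
have Ex : (x^T *m c%:M *m x) 0 0 = \sum_i \sum_j T i j * x i 0 ^+ 2.
  rewrite mul_mx_scalar -scalemxAl mxE mxE mulr_sumr; apply: eq_bigr => i _.
  by rewrite -mulr_suml Tc [x^T _ _]mxE.
have Ex' : \sum_i \sum_j T i j * x i 0 ^+ 2 = \sum_i \sum_j T i j * x j 0 ^+ 2.
  rewrite exchange_big /=; apply: eq_bigr => i _; apply: eq_bigr => j _.
  by rewrite Tsym.
rewrite mulmxBr mulmxBl mxE [X in _ + X]mxE (quad T).
suff : 0 <= \sum_i \sum_j (T i j * x i 0 ^+ 2 + T i j * x j 0 ^+ 2
    - 2 * (T i j * (x i 0 * x j 0))).
  under eq_bigr do rewrite sumrB big_split -mulr_sumr.
  rewrite sumrB big_split -mulr_sumr /= -Ex' -Ex; lra.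
apply: sumr_ge0 => i _; apply: sumr_ge0 => j _.
have := mulr_ge0 (T0 i j) (sqr_ge0 (x i 0 - x j 0)); nra.
Qed.

(** After scaling by [g], the terms [k = l] of the kernel add up to exactly the subtracted all-ones
    matrix; each remaining term is a cosine matrix at frequency [k - l]. *)
Lemma psd_fejer g n (a : 'I_n -> R) : (0 < g)%N ->
  psd (g%:R *: (\matrix_(i, j) fejer g (a i - a j)) - const_mx 1).
Proof.
move=> g0; have gR : g%:R != 0 :> R by rewrite pnatr_eq0 -lt0n.
have -> : g%:R *: (\matrix_(i, j) fejer g (a i - a j)) - const_mx 1 =
    g%:R^-1 *: \sum_(k < g) \sum_(l < g | l != k)
      (\matrix_(i, j) cos ((k%:R * a i - l%:R * a i) - (k%:R * a j - l%:R * a j))).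
  apply/matrixP => i j; rewrite !mxE summxE.
  under [X in _ = _ * X]eq_bigr do (rewrite summxE; under eq_bigr do rewrite mxE).
  rewrite /fejer; set S := \sum_(k < g) _; set S' := \sum_(k < g) _.
  have -> : S = g%:R + S'.
    rewrite /S /S' -[in g%:R](card_ord g) -sumr_const -big_split /=.
    apply: eq_bigr => k _; rewrite (bigD1 k) //= subrr cos0; congr (_ + _).
    by apply: eq_bigr => l _; congr cos; ring.
  by field.
apply: psdZ; first by rewrite invr_ge0.
by apply: psd_sum => k _; apply: psd_sum => l _; exact: psd_cos.
Qed.

End PositiveSemidefinite.

(** * The feasible matrix built from [G] (same class) and [T] (positions) *)

Section SimplicialSolution.
Set Implicit Arguments.
Unset Strict Implicit.
Variable R : realType.
Variables (n g m : nat) (G T : 'M[R]_n).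
Hypotheses (m_gt1 : (1 < m)%N) (g_gt1 : (1 < g)%N) (n_eq : n = (g * m)%N).
Hypotheses (G_sym : G^T = G) (G_diag : forall u, G u u = 1)
  (G_01 : forall u v, (G u v == 0) || (G u v == 1))
  (G_row : forall u, \sum_v G u v = m%:R) (G_sqr : G *m G = m%:R *: G).
Hypotheses (T_sym : T^T = T) (T_diag : forall i, T i i = 1)
  (T_01 : forall i j, 0 <= T i j <= 1) (T_row : forall i, \sum_j T i j = m%:R)
  (T_psd : psd (g%:R *: T - const_mx 1)).

Local Notation J := (const_mx 1 : 'M[R]_n).
Local Notation I := (1%:M : 'M[R]_n).

(* Two vertices of the same class sit at positions i <> j with probability
   proportional to T i j, two vertices of different classes with probability
   proportional to 1 - T i j. *)
Definition simplicial_sol : 'M[R]_(n * n) :=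
  n%:R^-1 *: (I *t I + (m%:R - 1)^-1 *: ((G - I) *t (T - I))
              + (n%:R - m%:R)^-1 *: ((J - G) *t (J - T))).

Let nE : n%:R = g%:R * m%:R :> R. Proof. by rewrite n_eq natrM. Qed.
Let m1 : 1 < m%:R :> R. Proof. by rewrite ltr1n. Qed.
Let g1 : 1 < g%:R :> R. Proof. by rewrite ltr1n. Qed.
Let m_neq0 : m%:R != 0 :> R. Proof. by rewrite gt_eqF // (lt_trans ltr01). Qed.
Let g_neq0 : g%:R != 0 :> R. Proof. by rewrite gt_eqF // (lt_trans ltr01). Qed.
Let m1_neq0 : m%:R - 1 != 0 :> R. Proof. by rewrite subr_eq0 gt_eqF. Qed.
Let g1_neq0 : g%:R - 1 != 0 :> R. Proof. by rewrite subr_eq0 gt_eqF. Qed.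
Let nm_gt0 : 0 < n%:R - m%:R :> R.
Proof. by rewrite nE -{2}(mul1r m%:R) -mulrBl mulr_gt0 ?subr_gt0 // (lt_trans ltr01). Qed.
Let gm_neq0 : g%:R * m%:R - m%:R != 0 :> R. Proof. by rewrite -nE gt_eqF. Qed.

Lemma simplicial_sol_ge0 k l : 0 <= simplicial_sol k l.
Proof.
case: (mxtens_indexP k) => u i; case: (mxtens_indexP l) => v j.
rewrite /simplicial_sol mxE mulr_ge0 ?invr_ge0 // !mxE !mxtens_indexK /=.
have [T0 T1] := andP (T_01 i j).
rewrite !addr_ge0 ?mulr_ge0 ?invr_ge0 ?subr_ge0 ?(ltW m1) // ?(ltW nm_gt0) //.
- by have [->|uv] := eqVneq u v; [rewrite G_diag|case/orP: (G_01 u v) => /eqP ->].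
- by have [->|ij] := eqVneq i j; [rewrite T_diag|].
- by rewrite -subr_ge0 ltW.
- by case/orP: (G_01 u v) => /eqP ->.
Qed.

(* The three summands live on the eigenspaces of [G]: vectors summing to zero
   on each class, vectors constant on each class and summing to zero, and
   constant vectors. *)
Lemma simplicial_sol_eigen : simplicial_sol = n%:R^-1 *:
  ((m%:R - 1)^-1 *: ((I - m%:R^-1 *: G) *t (m%:R%:M - T))
   + (g%:R - 1)^-1 *: ((m%:R^-1 *: G - n%:R^-1 *: J) *t (g%:R *: T - J))
   + (n%:R^-1 *: J) *t J).
Proof.
rewrite /simplicial_sol; congr (_ *: _); apply/matrixP => k l.
case: (mxtens_indexP k) => u i; case: (mxtens_indexP l) => v j.
rewrite !mxE !mxtens_indexK /= nE -[m%:R *+ _]mulr_natr.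
field.
by rewrite m_neq0 g_neq0 m1_neq0 g1_neq0 gm_neq0.
Qed.

Let GJ : G *m J = m%:R *: J.
Proof.
apply/matrixP => u v; rewrite !mxE -(G_row u) mulr1; apply: eq_bigr => w _.
by rewrite mxE mulr1.
Qed.

Let JG : J *m G = m%:R *: J.
Proof. by rewrite -[LHS]trmxK trmx_mul G_sym trmx_const GJ linearZ /= trmx_const. Qed.

Let JJ : J *m J = n%:R *: J.
Proof.
apply/matrixP => u v; rewrite !mxE; under eq_bigr do rewrite !mxE mulr1.
by rewrite sumr_const card_ord mulr1.
Qed.

(** The left tensor factors are orthogonal projections, since [G / m] and [J / n] are commuting
    ones. The right factors are semidefinite: [m I - T] by its constant row sums, [g T - J] by
    hypothesis, and [J] as a Gram matrix. *)
Lemma simplicial_sol_psd : psd simplicial_sol.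
Proof.
have nn0 : n%:R != 0 :> R by rewrite nE mulf_neq0.
rewrite simplicial_sol_eigen; apply: psdZ; first by rewrite invr_ge0.
apply: psdD; first apply: psdD.
- apply: psdZ; first by rewrite invr_ge0 subr_ge0 ltW.
  apply: psd_tens_idem.
  + by rewrite linearB linearZ /= trmx1 G_sym.
  + rewrite mulmxBl mul1mx mulmxBr mulmx1 -scalemxAl -scalemxAr G_sqr.
    by apply/matrixP => u v; rewrite !mxE; field.
  + apply: psd_scalar_sub => // i j; by case/andP: (T_01 i j).
- apply: psdZ; first by rewrite invr_ge0 subr_ge0 ltW.
  apply: psd_tens_idem => //.
  + by rewrite linearB !linearZ /= G_sym trmx_const.
  + rewrite mulmxBl !mulmxBr -!scalemxAl -!scalemxAr G_sqr GJ JG JJ !scalerA.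
    apply/matrixP => u v; rewrite !mxE nE; field.
    by rewrite m_neq0 g_neq0.
- apply: psd_tens_idem; last exact: psd_const1.
  + by rewrite linearZ /= trmx_const.
  + rewrite -!scalemxAl -!scalemxAr JJ !scalerA.
    by congr (_ *: _); field.
Qed.

Lemma mxtrace_simplicial_sol (A B : 'M[R]_n) :
  \tr ((A *t B) *m simplicial_sol) =
  n%:R^-1 * (\tr A * \tr B
    + (m%:R - 1)^-1 * (\tr (A *m (G - I)) * \tr (B *m (T - I)))
    + (n%:R - m%:R)^-1 * (\tr (A *m (J - G)) * \tr (B *m (J - T)))).
Proof.
rewrite /simplicial_sol -scalemxAr linearZ /=; congr (_ * _).
rewrite mulmxDr mulmxDr -!scalemxAr !mxtraceD !mxtraceZ !tensmx_mul.
by rewrite !mxtrace_tens !mulmx1.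
Qed.

Let trJ : \tr J = n%:R.
Proof. by rewrite /mxtrace; under eq_bigr do rewrite mxE; rewrite sumr_const card_ord. Qed.

Let tr_GI : \tr (G - I) = 0.
Proof. by rewrite /mxtrace big1 // => u _; rewrite !mxE G_diag eqxx subrr. Qed.

Let tr_TI : \tr (T - I) = 0.
Proof. by rewrite /mxtrace big1 // => u _; rewrite !mxE T_diag eqxx subrr. Qed.

Let tr_JG : \tr (J - G) = 0.
Proof. by rewrite /mxtrace big1 // => u _; rewrite !mxE G_diag subrr. Qed.

Let tr_JT : \tr (J - T) = 0.
Proof. by rewrite /mxtrace big1 // => u _; rewrite !mxE T_diag subrr. Qed.

Let tr_JI : \tr (J - I) = 0.
Proof. by rewrite /mxtrace big1 // => u _; rewrite !mxE eqxx subrr. Qed.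

Let tr_JmulT : \tr (J *m T) = n%:R * m%:R.
Proof.
rewrite mxtrace_mulC /mxtrace; under eq_bigr => u _.
  rewrite mxE; under eq_bigr do rewrite [X in _ * X]mxE mulr1.
  rewrite T_row; over.
by rewrite sumr_const card_ord mulr_natl.
Qed.

(** [G - I], [T - I], [J - G] and [J - T] have zero diagonal, so in the first three trace
    constraints only the term [I *t I] can contribute; the last one follows from the row sums of [G]
    and [T]. *)
Lemma simplicial_sol_feasible : SDP2_feasible simplicial_sol.
Proof.
have nn0 : n%:R != 0 :> R by rewrite nE mulf_neq0.
split; [exact: simplicial_sol_ge0 | exact: simplicial_sol_psd | split].
- move=> j; rewrite mxtrace_simplicial_sol !mul1mx tr_GI tr_JG !mul0r !mulr0 !addr0.
  by rewrite mxtrace1 mxtrace_delta mulr1 mulVf.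
- move=> j; rewrite mxtrace_simplicial_sol !mul1mx tr_TI tr_JT !mulr0 !addr0.
  by rewrite mxtrace1 mxtrace_delta mul1r mulVf.
- rewrite mulmxDl linearD /= !mxtrace_simplicial_sol !mul1mx tr_GI tr_JG tr_TI.
  by rewrite tr_JT tr_JI !(mul0r, mulr0, addr0). 
- rewrite mxtrace_simplicial_sol !mulmxBr !mulmx1 JJ JG !mxtraceB !mxtraceZ.
  rewrite tr_JmulT trJ nE; field.
  by rewrite m_neq0 g_neq0 m1_neq0 gm_neq0.
Qed.

(* [J - G] is the distance matrix of the simplicial instance. *)
Lemma mxtrace_simplicial_sol_dist (B : 'M[R]_n) :
  \tr (((J - G) *t B) *m simplicial_sol) = \tr (B *m (J - T)).
Proof.
have nn0 : n%:R != 0 :> R by rewrite nE mulf_neq0.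
have nm0 : n%:R - m%:R != 0 :> R by rewrite gt_eqF.
have -> : \tr (((J - G) *t B) *m simplicial_sol) = n%:R^-1 *
    ((n%:R - m%:R)^-1 * ((n%:R - m%:R) * n%:R * \tr (B *m (J - T)))).
  rewrite mxtrace_simplicial_sol tr_JG mul0r add0r.
  (* A multiple of [J - G] has trace zero, so only inequivalent pairs are charged. *)
  have -> : (J - G) *m (G - I) = (m%:R - 1) *: (J - G).
    by rewrite mulmxBr !mulmxBl !mulmx1 JG G_sqr; apply/matrixP => u v; rewrite !mxE; ring.
  have -> : (J - G) *m (J - G) = (n%:R - m%:R) *: J - m%:R *: (J - G).
    rewrite mulmxBr !mulmxBl JJ JG GJ G_sqr; apply/matrixP => u v; rewrite !mxE; ring.
  by rewrite mxtraceZ tr_JG mxtraceB !mxtraceZ tr_JG trJ !(mulr0, mul0r) add0r subr0.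
by field; rewrite nn0 nm0.
Qed.

Lemma simplicial_sol_diag k : simplicial_sol k k = n%:R^-1.
Proof.
case: (mxtens_indexP k) => u i.
rewrite /simplicial_sol !mxE !mxtens_indexK /= G_diag T_diag !eqxx !subrr !mulr0 !addr0 !mulr1.
by [].
Qed.

End SimplicialSolution.

(** * The cycle with one position deleted *)

Section CycleAdjacency.
Set Implicit Arguments.
Unset Strict Implicit.
Variable R : realType.

(** Once [r] is removed and the rest renumbered, neighbours on the long cycle are still consecutive
    modulo [n], which makes a kernel on the [n]-th roots of unity suitable. *)
Lemma ordS_lift n (r : 'I_n.+1) (i j : 'I_n) : ordS (lift r i) = lift r j ->
  j = i.+1 :> nat \/ i.+1 = n /\ j = 0 :> nat.
Proof.
move/(congr1 val); rewrite /= /bump.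
move: (ltn_ord r) (ltn_ord i) (ltn_ord j) => ltr lti ltj.
have [ij|ij] := eqVneq (((r <= i) + i).+1)%N n.+1; first by rewrite ij modnn; lia.
by rewrite modn_small; lia.
Qed.

Lemma cycle_adj_ge0 N (i j : 'I_N) : 0 <= cycle_adj R N i j.
Proof. by rewrite mxE. Qed.

Lemma cycle_adj_row N (i : 'I_N) : \sum_j cycle_adj R N i j <= 2.
Proof.
have sum1 (k : 'I_N) : \sum_(j < N) (j == k)%:R = 1 :> R.
  rewrite (bigD1 k) //= eqxx big1 ?addr0 // => j jk; by rewrite (negbTE jk).
(* Only an inequality: successor and predecessor coincide when [N <= 2]. *)
apply: (@le_trans _ _ (\sum_(j < N) ((j == ordS i)%:R + (j == ord_pred i)%:R))).
  apply: ler_sum => j _; rewrite mxE [i == _]eq_sym (can2_eq (@ordSK N) (@ord_predK N)).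
  by do 2!case: eqP => _; rewrite ?addr0 ?add0r // lerDl.
by rewrite big_split /= !sum1.
Qed.

Lemma cycle_adj_lift_row n (r : 'I_n.+1) k :
  \sum_(j < n) cycle_adj R n.+1 k (lift r j) <= 2.
Proof.
apply: le_trans (cycle_adj_row k).
by rewrite [leRHS](bigD1_ord r) //= lerDr cycle_adj_ge0.
Qed.

Lemma fejer_cycle_adj g n (r : 'I_n.+1) (i j : 'I_n)
    (a := fun k : 'I_n => 2 * pi / n%:R * k%:R) : (0 < g)%N ->
  cycle_adj R n.+1 (lift r i) (lift r j) *
    (1 - fejer g (a i - a j)) <=
  cycle_adj R n.+1 (lift r i) (lift r j) *
    ((g%:R * (2 * pi / n%:R)) ^+ 2 / 2).
Proof.
move=> g0; set y := 2 * pi / n%:R.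
have step (k l : 'I_n) : ordS (lift r k) = lift r l ->
    fejer g (a k - a l) = fejer g y.
  have nR : n%:R != 0 :> R.
    by rewrite pnatr_eq0 -lt0n (leq_ltn_trans (leq0n k)).
  case/ordS_lift => [lk|[kn l0]].
  - by rewrite -[RHS]fejerN /a lk -natr1; congr fejer; rewrite /y; ring.
  (* The wrap-around pair [(n - 1, 0)] has the same angle up to a full turn. *)
  - rewrite -[RHS]fejerN -[RHS]fejerD2pi /a l0; congr fejer.
    have kR : k%:R + 1 = n%:R :> R by rewrite natr1 kn.
    have -> : k%:R = n%:R - 1 :> R by rewrite -kR addrK.
    by rewrite /y -[pi *+ 2]mulr_natl; field.
rewrite [cycle_adj _ _ _ _]mxE.
case: eqP => [/esym/step ->|_]; first by rewrite /= !mul1r one_sub_fejer_le.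
case: eqP => [/esym/step E|_]; last by rewrite !mul0r.
by rewrite !mul1r -fejerN opprB E one_sub_fejer_le.
Qed.

End CycleAdjacency.

(** * Simplicial instances: tour lower bound and SDP upper bound *)

Section SimplicialInstance.
Set Implicit Arguments.
Unset Strict Implicit.
Variable R : realType.

Definition simplicial_dist N (K : eqType) (f : 'I_N -> K) : 'M[R]_N :=
  \matrix_(u, v) (f u != f v)%:R.

Lemma simplicial_dist_tsp N (K : eqType) (f : 'I_N -> K) :
  tsp_instance (simplicial_dist f).
Proof.
split=> [|u v|u|u v w]; rewrite ?mxE ?eqxx //.
  by apply/matrixP => u v; rewrite !mxE eq_sym.
rewrite -natrD ler_nat.
by have [->|_] := eqVneq (f u) (f w); case: (_ != _).
Qed.

(** A tour reaches every position from every other; adding [N - i] avoids a truncated subtraction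
    when [j < i]. *)
Lemma iter_ordS N (i j : 'I_N) : iter (j + (N - i)) (@ordS N) i = j.
Proof.
have itE k : iter k (@ordS N) i = ((i + k) %% N)%N :> nat.
  elim: k => [|k IH]; first by rewrite addn0 modn_small.
  by rewrite iterS /= IH -addn1 modnDml addn1 addnS.
apply/val_inj; rewrite /= itE addnCA subnKC ?(ltnW (ltn_ord i)) //.
by rewrite modnDr modn_small.
Qed.

(* The tour leaves each of the classes at least once. *)
Lemma simplicial_tour_cost_ge N (K : finType) (f : 'I_N -> K) (p : 'S_N) :
  (1 < #|K|)%N -> (forall a, exists u, f u = a) ->
  #|K|%:R <= tour_cost (simplicial_dist f) p.
Proof.
move=> K1 fsurj; rewrite /tour_cost (partition_big (fun i => f (p i)) xpredT) //=.
rewrite -sum1_card natr_sum; apply: ler_sum => a _.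
have [u ua] := fsurj a.
have [b ba] : exists b, b != a.
  have /card_gt1P [x [y [_ _ xy]]] := K1.
  by have [xa|] := eqVneq x a; [exists y; rewrite -xa eq_sym|exists x].
have [v vb] := fsurj b.
(* Otherwise the tour started at [u] would stay in class [a] forever, yet it reaches [v] in class
   [b]. *)
have [i /andP[fi fSi]] : exists i, (f (p i) == a) && (f (p (ordS i)) != a).
  apply/existsP; apply: contraT; rewrite negb_exists => /forallP H.
  have stay k : f (p (iter k (@ordS N) ((p^-1)%g u))) = a.
    elim: k => [|k IH]; first by rewrite /= permKV.
    by have := H (iter k (@ordS N) ((p^-1)%g u)); rewrite IH eqxx /= negbK => /eqP.
  have := stay ((p^-1)%g v + (N - (p^-1)%g u))%N; rewrite iter_ordS permKV vb => E.
  by rewrite E eqxx in ba.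
rewrite (bigD1 i) //= mxE (eqP fi) eq_sym fSi lerDl sumr_ge0 // => j _.
by rewrite mxE.
Qed.

Lemma simplicial_OPT_ge N (K : finType) (f : 'I_N -> K) :
  (1 < #|K|)%N -> (forall a, exists u, f u = a) ->
  #|K|%:R <= OPT_TSP (simplicial_dist f).
Proof.
move=> K1 fsurj; apply: le_bigmin => [|p _]; exact: simplicial_tour_cost_ge.
Qed.

Lemma mxtrace_mul_ge0 n (A B : 'M[R]_n) :
  (forall i j, 0 <= A i j) -> (forall i j, 0 <= B i j) -> 0 <= \tr (A *m B).
Proof.
move=> A0 B0; apply: sumr_ge0 => i _; rewrite mxE.
by apply: sumr_ge0 => j _; rewrite mulr_ge0.
Qed.

Lemma SDP2_cost_ge0 n (r s : 'I_n.+1) (D : 'M[R]_n.+1) :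
  (forall u v, 0 <= D u v) -> forall k l, 0 <= SDP2_cost r s D k l.
Proof.
move=> D0 k l; rewrite mxE addr_ge0 //.
  by rewrite mxE mulr_ge0 // !mxE // mulr_ge0 // invr_ge0.
by rewrite mxE mulrn_wge0 // !mxE big_ord1 !mxE mulr_ge0.
Qed.

(** Excludes a negative denominator, for which an upper bound on the SDP value would say nothing
    about the ratio. *)
Lemma OPT_SDP2_ge0 n (r s : 'I_n.+1) (D : 'M[R]_n.+1) :
  (forall u v, 0 <= D u v) -> (0 <= OPT_SDP2 r s D)%E.
Proof.
move=> D0; apply: le_ereal_inf_tmp => _ [Y [Y0 _ _] <-]; rewrite lee_fin.
by apply: mxtrace_mul_ge0 => // k l; exact: SDP2_cost_ge0.
Qed.

Definition block g m (u : 'I_(g * m)) : 'I_g := (mxtens_unindex u).1.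

(* The vertex [s] forms a class of its own. *)
Definition vertex_class g m (s : 'I_(g * m).+1) (v : 'I_(g * m).+1) : option 'I_g :=
  omap (@block g m) (unlift s v).

Definition same_block g m : 'M[R]_(g * m) := \matrix_(u, v) (block u == block v)%:R.

Lemma same_block_row g m (u : 'I_(g * m)) : \sum_v same_block g m u v = m%:R.
Proof.
rewrite sum_mxtens_index (bigD1 (block u)) //= [X in _ + X]big1 ?addr0 => [|a au].
  under eq_bigr do rewrite mxE /block mxtens_indexK eqxx.
  by rewrite sumr_const card_ord.
by apply: big1 => b _; rewrite mxE {2}/block mxtens_indexK eq_sym (negbTE au).
Qed.

Lemma same_block_sqr g m :
  same_block g m *m same_block g m = m%:R *: same_block g m.
Proof.
apply/matrixP => u v; rewrite mxE [RHS]mxE -(same_block_row u) mulr_suml.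
apply: eq_bigr => w _; rewrite !mxE.
by have [->|] := eqVneq (block u) (block w); rewrite ?mul0r.
Qed.

(** Position [i] sits at the angle [2 pi i / n], which makes this a circulant matrix. *)
Definition fejer_mx g n : 'M[R]_n :=
  \matrix_(i, j) fejer g (2 * pi / n%:R * i%:R - 2 * pi / n%:R * j%:R).

Lemma OPT_SDP2_simplicial_le g (m := (32 * g)%N) (r s : 'I_(g * m).+1) :
  (1 < g)%N ->
  (OPT_SDP2 r s (simplicial_dist (vertex_class s)) <= 3%:R%:E)%E.
Proof.
move=> g1; have g0 : (0 < g)%N by exact: ltnW.
have m1 : (1 < m)%N by rewrite /m; lia.
set D := simplicial_dist _; set n := (g * m)%N.
have gn : (0 < g <= n)%N by rewrite g0 leq_pmulr // ltnW.
have gR : g%:R != 0 :> R by rewrite pnatr_eq0 -lt0n.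
have n0 : 0 < n%:R :> R by rewrite ltr0n; case/andP: gn; exact: leq_trans.
pose G := same_block g m; pose T := fejer_mx g n.
have GT : G^T = G by apply/matrixP => u v; rewrite !mxE eq_sym.
have G1 u : G u u = 1 by rewrite mxE eqxx.
have G01 u v : (G u v == 0) || (G u v == 1).
  by rewrite mxE; case: (block u == block v); rewrite eqxx ?orbT.
have T1 i : T i i = 1 by rewrite mxE subrr fejer0.
have TT : T^T = T by apply/matrixP => i j; rewrite !mxE -fejerN opprB.
have T01 i j : 0 <= T i j <= 1 by rewrite mxE fejer_ge0 fejer_le1.
have Trow i : \sum_j T i j = m%:R.
  under eq_bigr do rewrite mxE.
  by rewrite sum_fejer // natrM mulrAC mulfV // mul1r.
have Tpsd : psd (g%:R *: T - const_mx 1) by exact: psd_fejer.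
pose Y := simplicial_sol m G T.
have YF : SDP2_feasible Y.
  by apply: (@simplicial_sol_feasible R n g m) => //; [exact: same_block_row|exact: same_block_sqr].
apply: (@le_trans _ _ (\tr (SDP2_cost r s D *m Y))%:E).
  by apply: ereal_inf_lbound; exists Y.
rewrite lee_fin /SDP2_cost.
have -> : row' s (col' s D) = const_mx 1 - G.
  apply/matrixP => u v; rewrite !mxE /vertex_class !liftK /=.
  have -> : (Some (block u) == Some (block v)) = (block u == block v) by [].
  by case: eqP; rewrite ?subrr ?subr0.
rewrite mulmxDl mxtraceD (@mxtrace_simplicial_sol_dist R n g m) //; last 2 first.
- exact: same_block_row.
- exact: same_block_sqr.
(* The edges among the other vertices cost at most 1, the two edges at [s] at most 2. *)
have -> : 3 = 1 + 2 :> R by lra.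
apply: lerD.
- rewrite -scalemxAl mxtraceZ ler_pdivrMl //.
  set eps : R := (g%:R * (2 * pi / n%:R)) ^+ 2 / 2.
  apply: (@le_trans _ _ (\sum_(i < n) 2 * eps)); last first.
    rewrite sumr_const card_ord -[leLHS]mulr_natr -mulrA ler_pM2l // /eps.
    (* The factor 32 in [m] is chosen here: [n = 32 g ^ 2] leaves [pi ^ 2 / 16], which is below 1
       since [pi < 4]. *)
    have -> : (g%:R * (2 * pi / n%:R)) ^+ 2 / 2 * n%:R = pi ^+ 2 / 16 :> R.
      by rewrite /n /m !natrM; field.
    rewrite ler_pdivrMr // mul1r.
    by have := @pihalf_lt2 R; have := pi_gt0 R; nra.
  apply: ler_sum => i _; rewrite mxE.
  apply: (@le_trans _ _ (\sum_(j < n) cycle_adj R n.+1 (lift r i) (lift r j) * eps)).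
    apply: ler_sum => j _; rewrite [(row' r _) _ _]mxE [(col' r _) _ _]mxE.
    have -> : (const_mx 1 - T) j i = 1 - T i j by rewrite !mxE -fejerN opprB.
    by rewrite [T i j]mxE; exact: fejer_cycle_adj.
  rewrite -mulr_suml ler_wpM2r ?cycle_adj_lift_row //.
  by rewrite /eps divr_ge0 ?sqr_ge0.
- rewrite /mxtrace sum_mxtens_index.
  (* Each vertex [u] is at distance 1 from [s] and occupies each of the at most two positions next
     to [r] with weight [1 / n]. *)
  apply: (@le_trans _ _ (\sum_(u < n) n%:R^-1 * 2)); last first.
    by rewrite sumr_const card_ord -[leLHS]mulr_natl mulrA mulfV ?mul1r // gt_eqF.
  apply: ler_sum => u _.
  apply: (@le_trans _ _ (n%:R^-1 * \sum_(i < n) cycle_adj R n.+1 r (lift r i))).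
    rewrite mulr_sumr; apply: ler_sum => i _.
    rewrite mul_diag_mx mxE simplicial_sol_diag // mulrC ler_wpM2l ?invr_ge0 //.
    rewrite mxE mxtens_indexK /= mxE big_ord1 !mxE /vertex_class unlift_none liftK.
    by rewrite /= mulr1 orbC.
  by rewrite ler_wpM2l ?invr_ge0 // cycle_adj_lift_row.
Qed.

End SimplicialInstance.

Theorem theorem4p1 (R : realType) (r s : forall n : nat, 'I_n.+1)
  (z : nat) (hz : (1 <= z)%N) :
  (z%:R%:E <= SDP2_integrality_gap R r s)%E.
Proof.
(* With [s] there are [3 z + 1] classes against an SDP value of at most 3, so the ratio is at least
   [z]. *)
pose g := (3 * z)%N; pose m := (32 * g)%N; pose n := (g * m)%N.
have g1 : (1 < g)%N by rewrite /g; lia.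
pose D : 'M[R]_n.+1 := simplicial_dist R (@vertex_class g m (s n)).
have cardK : #|{: option 'I_g}| = g.+1 by rewrite card_option card_ord.
have OPTge : g.+1%:R <= OPT_TSP D.
  rewrite -cardK; apply: simplicial_OPT_ge; first by rewrite cardK; lia.
  case=> [a|]; last by exists (s n); rewrite /vertex_class unlift_none.
  have m0 : (0 < m)%N by rewrite /m; lia.
  exists (lift (s n) (mxtens_index (a, Ordinal m0))).
  by rewrite /vertex_class liftK /= /block mxtens_indexK.
have OPT0 : 0 < OPT_TSP D by apply: lt_le_trans OPTge; rewrite ltr0n.
have Dtsp : tsp_instance D by exact: simplicial_dist_tsp.
have SDPle : (OPT_SDP2 (r n) (s n) D <= 3%:R%:E)%E by exact: OPT_SDP2_simplicial_le.
have SDPge : (0 <= OPT_SDP2 (r n) (s n) D)%E.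
  by case: Dtsp => _ D0 _ _; exact: OPT_SDP2_ge0.
apply: (@le_trans _ _ ((OPT_TSP D)%:E / OPT_SDP2 (r n) (s n) D)%E); last first.
  apply: ereal_sup_ubound; exists n, D; split=> //; last by rewrite gt_eqF.
  by rewrite /n /m; nia.
(* Attainment makes the SDP value a real number, so the division can be carried out in [R] unless
   that value is 0, when the ratio is [+oo]. *)
have [Y _ E] := OPT_SDP2_attained (r n) (s n) D.
rewrite E !lee_fin in SDPge SDPle *; rewrite inver.
case: eqP => [_|/eqP t0]; first by rewrite gt0_muley ?leey // lte_fin.
rewrite -EFinM lee_fin ler_pdivlMr ?lt0r ?t0 //.
apply: le_trans OPTge; apply: (@le_trans _ _ (z%:R * 3%:R)).
  by rewrite ler_wpM2l.
by rewrite -natrM ler_nat /g; lia.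
Qed.
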